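(* Let $b\in\mathbb{N}$ and let $S$ be a semigroup that is both $b$-weakly left cancellative and $b$-weakly right cancellative. Let $\mathcal{F}=\langle F_i\rangle_{i\in I}$ be a net in $\mathcal{P}_f(S)$ which satisfies condition $( * )$. Then every central set in $S$ is a $D$-set in $S$ with respect to $\mathcal{F}$.
   Context: Semigroups are nonempty and discrete; $\mathbb{N}=\{1,2,\dots\}$; $\mathcal{P}_f(X)$ is the set of finite nonempty subsets of $X$. $\beta S$ is the space of ultrafilters on $S$ (Stone–Čech compactification), with basic open sets $\overline{A}=\{p\in\beta S: A\in p\}$ for $A\subseteq S$, and semigroup operation $pq=\{A\subseteq S:\{s\in S: s^{-1}A\in q\}\in p\}$, where $s^{-1}A=\{t\in S: st\in A\}$. $K(\beta S)$ denotes the smallest two-sided ideal of $\beta S$. A set $A\subseteq S$ is central if $A\in p$ for some idempotent $p\in K(\beta S)$. For a net $\mathcal{F}=\langle F_i\rangle_{i\in I}$ in $\mathcal{P}_f(S)$ ($I$ a directed set) and $A\subseteq S$, the upper Banach density of $A$ with respect to $\mathcal{F}$ is $$d_{\mathcal{F}}^*(A)=\sup\{\alpha: (\forall i_0\in I)(\exists i\geq i_0)(\exists s\in S\cup\{1\})(|A\cap(F_i\cdot s)|\geq\alpha|F_i|)\},$$ where $F_i\cdot 1$ means $F_i$ ($S$ is not assumed to have an identity). Put $D_{\mathcal{F}}^*=\{p\in\beta S:(\forall A\in p)(d_{\mathcal{F}}^*(A)>0)\}$. A subset $A\subseteq S$ is a $D$-set with respect to $\mathcal{F}$ if $A\in p$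 for some idempotent $p$ ($pp=p$) of $\beta S$ with $p\in D_{\mathcal{F}}^*$. $S$ is $b$-weakly left cancellative (respectively $b$-weakly right cancellative) if for all $t,u\in S$, $|\{s\in S: ts=u\}|\leq b$ (respectively $|\{s\in S: st=u\}|\leq b$). Condition $( * )$ for $\mathcal{F}$: $(\forall\epsilon>0)(\forall t\in S)(\exists c\in\mathbb{N})(\exists l\in I)(\forall i_0\geq l)(\exists i\geq i_0)(\exists s\in S\cup\{1\})\big(|(t\cdot F_{i_0})\setminus(F_i\cdot s)|<\epsilon\cdot|F_{i_0}|\text{ and }|F_i|\leq c\cdot|F_{i_0}|\big)$. *)

(* Defs.v *)
From HB Require Import structures.
From mathcomp Require Import all_boot all_order all_algebra.
From mathcomp Require Import finmap.
From mathcomp Require Import all_classical all_reals.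
Set Implicit Arguments.
Unset Strict Implicit.
Unset Printing Implicit Defensive.

Import Order.TTheory GRing.Theory Num.Theory.
Local Open Scope classical_set_scope.

Record beta (S : Type) := Beta {
  beta_sets :> set S -> Prop;
  beta_ultra : @UltraFilter S beta_sets }.

#[global] Existing Instance beta_ultra.

HB.instance Definition _ (S : Type) := gen_eqMixin (beta S).
HB.instance Definition _ (S : Type) := gen_choiceMixin (beta S).

Lemma beta_eq (S : Type) (p q : beta S) : beta_sets p = beta_sets q -> p = q.
Proof.
case: p q => [p up] [q uq] /= epq; case: _ / epq uq => uq.
by rewrite (Prop_irrelevance up uq).
Qed.

Definition beta_mul_sets (S : semigroupType) (p q : set_system S)
    : set_system S :=
  [set A | p [set s | q [set t | A (s * t)%g]]].

Lemma beta_mul_ultra (S : semigroupType) (p q : beta S) :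
  UltraFilter (beta_mul_sets p q).
Proof.
have mulPF : ProperFilter (beta_mul_sets p q).
  rewrite /beta_mul_sets; split; last split=> /=.
  - by move=> /= p0; have [s /= q0] := filter_ex p0; have [t] := filter_ex q0.
  - by apply: (@filterE _ p) => s; apply: (@filterE _ q).
  - by move=> A B; apply: (@filterS2 _ p) => s; apply: (@filterS2 _ q) => t.
  - move=> A B AB; apply: (@filterS _ p) => s.
    by apply: (@filterS _ q) => t; exact: AB.
split=> // G GF sG; apply/seteqP; split=> // A GA.
have [//|pqN] : beta_mul_sets p q A \/ beta_mul_sets p q (~` A).
  case: (in_ultra_setVsetC [set s | q [set t | A (s * t)%g]] (beta_ultra p)).
    by left.
  move=> pN; right; apply: filterS pN => s /= nq.
  by case: (in_ultra_setVsetC [set t | A (s * t)%g] (beta_ultra q)).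
have GAN : G (A `&` ~` A) by apply: filterI GA _; exact: sG.
by have [x []] := filter_ex GAN.
Qed.

Definition beta_mul (S : semigroupType) (p q : beta S) : beta S :=
  Beta (beta_mul_ultra p q).

Lemma beta_mulA (S : semigroupType) : associative (@beta_mul S).
Proof.
move=> p q r; apply: beta_eq; apply/funext => A /=.
rewrite /beta_mul_sets /=; congr (beta_sets p _); apply/funext => s /=.
congr (beta_sets q _); apply/funext => t /=.
by congr (beta_sets r _); apply/funext => u /=; rewrite mulgA.
Qed.

HB.instance Definition _ (S : semigroupType) := hasMul.Build (beta S) (@beta_mul S).
HB.instance Definition _ (S : semigroupType) :=
  Magma_isSemigroup.Build (beta S) (@beta_mulA S).

Definition two_sided_ideal (T : semigroupType) (J : set T) : Prop :=
  J !=set0 /\ forall x y : T, J y -> J (x * y)%g /\ J (y * x)%g.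

(* This intersection of all two-sided ideals is the smallest one whenever
   a smallest one exists, as is the case in [beta S]. *)
Definition min_ideal (T : semigroupType) : set T :=
  smallest (@two_sided_ideal T) set0.

Definition central (S : semigroupType) (A : set S) : Prop :=
  exists p : beta S, (p * p)%g = p /\ min_ideal p /\ p A.

Definition weakly_left_cancellative (b : nat) (S : semigroupType) : Prop :=
  forall t u : S, ([set s : S | (t * s)%g = u] #<= `I_b)%card.

Definition weakly_right_cancellative (b : nat) (S : semigroupType) : Prop :=
  forall t u : S, ([set s : S | (s * t)%g = u] #<= `I_b)%card.

Definition directed (d : Order.disp_t) (I : preorderType d) : Prop :=
  [set: I] !=set0 /\ forall i j : I, exists k, (i <= k)%O /\ (j <= k)%O.

Definition ltrans (S : semigroupType) (t : S) (F : {fset S}) : {fset S} :=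
  [fset (t * x)%g | x in F]%fset.

(* [option S] stands for S with a formal identity [None] adjoined. *)
Definition rtrans (S : semigroupType) (F : {fset S}) (s : option S)
    : {fset S} :=
  if s is Some s' then [fset (x * s')%g | x in F]%fset else F.

Section Density.
Local Open Scope ring_scope.
Variables (R : realType) (S : semigroupType).
Variables (d : Order.disp_t) (I : preorderType d) (F : I -> {fset S}).

Definition upper_density (A : set S) : R :=
  sup [set alpha : R | forall i0 : I, exists i : I, (i0 <= i)%O /\
    exists s : option S,
      #|` [fset x in rtrans (F i) s | x \in A]%fset|%:R >= alpha * #|` F i|%:R].

Definition Dstar : set (beta S) :=
  [set p : beta S | forall A : set S, p A -> 0 < upper_density A].

Definition D_set (A : set S) : Prop :=
  exists p : beta S, (p * p)%g = p /\ Dstar p /\ p A.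

Definition condition_star : Prop :=
  forall (e : R), 0 < e -> forall t : S,
  exists (c : nat) (l : I), (0 < c)%N /\
  forall i0 : I, (l <= i0)%O -> exists i : I, (i0 <= i)%O /\
  exists s : option S,
    #|` (ltrans t (F i0) `\` rtrans (F i) s)%fset|%:R < e * #|` F i0|%:R
    /\ (#|` F i| <= c * #|` F i0|)%N.

End Density.

(* Main.v *)
(** The set Dstar is a two-sided ideal of beta S, hence contains its smallest
    ideal, and so every idempotent witnessing centrality also witnesses being a
    D-set. Positive upper density is partition regular along a directed set, so
    Dstar is nonempty. Right translation by t shrinks a finite set by a factor of
    at most b, so Dstar absorbs multiplication on the right; left translation
    shrinks likewise, and condition ( * ) moves t F_i0 back into some F_i s up to
    a small proportion, so Dstar absorbs multiplication on the left. *)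
Require Import Defs.
From mathcomp Require Import all_boot all_order all_algebra.
From mathcomp Require Import finmap.
From mathcomp Require Import all_classical all_reals.
From mathcomp Require Import ring lra.
Set Implicit Arguments.
Unset Strict Implicit.
Unset Printing Implicit Defensive.
Import Order.TTheory GRing.Theory Num.Theory.
Local Open Scope classical_set_scope.
Local Open Scope ring_scope.

(** Sum the fibre sizes over the image. Both weak cancellation hypotheses enter only through this
    bound. *)
Lemma leq_card_imfset_fibers (T U : choiceType) (f : T -> U) (b : nat)
    (X : {fset T}) :
  (forall y, [set x | f x = y] #<= `I_b)%card ->
  (#|` X| <= b * #|` [fset f x | x in X]%fset|)%N.
Proof.
move=> fib; rewrite card_fset_sum1 (partition_big_imfset _ f).
rewrite [X in (_ <= _ * X)%N]card_fset_sum1 big_distrr /=.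
apply: leq_sum => y _; rewrite muln1.
have -> : (\sum_(i <- X | f i == y) 1)%N
          = #|` [fset x in X | f x == y]%fset|.
  by rewrite card_fset_sum1 big_fset.
rewrite -[[fset x in X | _]%fset]set_fsetK; apply: geq_card_fset_set.
apply: card_le_trans (fib y); apply: subset_card_le => x /=.
by rewrite !inE => /andP[_ /eqP].
Qed.

Section OptionAction.
Variable S : semigroupType.
Implicit Types (x t : S) (s : option S) (X : {fset S}).

(** The right action on [S] of the monoid obtained by adjoining an identity, whose product is
    [omul]; it treats F_i and F_i s uniformly and lets translates compose. *)
Definition oact x s : S := if s is Some s' then (x * s')%g else x.

Definition omul s1 s2 : option S :=
  match s1, s2 with
  | None, _ => s2
  | _, None => s1
  | Some a, Some b => Some (a * b)%g
  end.

Lemma oact_omul x s1 s2 : oact x (omul s1 s2) = oact (oact x s1) s2.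
Proof. by case: s1 s2 => [a|] [c|] //=; rewrite mulgA. Qed.

Lemma oactMl t x s : oact (t * x)%g s = (t * oact x s)%g.
Proof. by case: s => [a|] //=; rewrite mulgA. Qed.

Lemma rtransE X s : rtrans X s = [fset oact x s | x in X]%fset.
Proof.
case: s => [a|] //=; apply/fsetP => x; apply/idP/imfsetP => [xX|[y yX ->]//].
by exists x.
Qed.

Lemma card_rtrans X s : (#|` rtrans X s| <= #|` X|)%N.
Proof. by rewrite rtransE; exact: leq_imfset_card. Qed.

End OptionAction.

Section Dstar_ideal.
Variables (R : realType) (S : semigroupType).
Variables (d : Order.disp_t) (I : preorderType d) (F : I -> {fset S}).
Hypotheses (hI : directed I) (hF : forall i, F i != fset0).

(** Membership of [a] in the set whose supremum is [upper_density]. *)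
Definition dense_level (A : set S) (a : R) := forall i0 : I, exists i : I,
  (i0 <= i)%O /\ exists s : option S,
  a * #|` F i|%:R <= #|` [fset x in rtrans (F i) s | x \in A]%fset|%:R.

Definition positive_density (A : set S) := exists2 a : R, 0 < a & dense_level A a.

Let F_gt0 i : 0 < #|` F i|%:R :> R.
Proof. by rewrite ltr0n cardfs_gt0. Qed.

(** Translation does not enlarge F_i. The bound matters because [sup] of an unbounded set defaults
    to 0. *)
Lemma dense_level_le1 A a : dense_level A a -> a <= 1.
Proof.
have [[i0 _] _] := hI.
move=> /(_ i0)[i [_ [s /le_trans le_a]]]; rewrite -(ler_pM2r (F_gt0 i)) mul1r.
apply: le_a; rewrite ler_nat; apply: leq_trans (card_rtrans _ s).
by apply: fsubset_leq_card; apply/fsubsetP => x; rewrite !inE => /andP[].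
Qed.

Lemma upper_density_gt0P A :
  0 < upper_density R F A <-> positive_density A.
Proof.
split=> [/sup_gt[|a Ea a0]|[a a0 Ea]].
- exists 0 => /= i0; exists i0; split=> //.
  by exists None; rewrite mul0r.
- by exists a.
- apply: (lt_le_trans a0); apply: ub_le_sup => //.
  by exists 1 => x; exact: dense_level_le1.
Qed.

Lemma positive_densityS A B : A `<=` B ->
  positive_density A -> positive_density B.
Proof.
move=> AB [a a0 Aa]; exists a => // i0; have [i [i0i [s As]]] := Aa i0.
exists i; split => //; exists s; apply: le_trans As _; rewrite ler_nat.
apply: fsubset_leq_card; apply/fsubsetP => x; rewrite !inE => /andP[-> /=].
by move=> /set_mem /AB /mem_set.
Qed.

Lemma positive_density_setU A B : positive_density (A `|` B) ->
  positive_density A \/ positive_density B.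
Proof.
move=> [a a0 ABa].
have half_gt0 : 0 < a / 2 by rewrite divr_gt0.
have [Aa|nA] := pselect (dense_level A (a / 2)); first by left; exists (a / 2).
right; exists (a / 2) => // i0.
(* Past [i1] every translate of F_i meets A in proportion below a/2. At an index past both [i0] and
   [i1] where the union has proportion a, the other half must come from B. *)
have /existsNP[i1 nA1] := nA.
have [j [i0j i1j]] := hI.2 i0 i1.
have [i [ji [s ABs]]] := ABa j.
exists i; split; first exact: le_trans ji.
exists s; rewrite leNgt; apply/negP => Bs.
apply: nA1; exists i; split; first exact: le_trans ji.
exists s.
have leU : (#|` [fset x in rtrans (F i) s | x \in (A `|` B)%classic]%fset|
    <= #|` [fset x in rtrans (F i) s | x \in A]%fset|
     + #|` [fset x in rtrans (F i) s | x \in B]%fset|)%N.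
  apply: leq_trans (leq_card_fsetU _ _).1; apply: fsubset_leq_card.
  apply/fsubsetP => x; rewrite !inE => /andP[-> /=].
  by rewrite in_setU.
move: leU; rewrite -(ler_nat R) natrD => leU.
by lra.
Qed.

Lemma not_positive_density0 : ~ positive_density set0.
Proof.
have [[i0 _] _] := hI.
move=> [a a0 /(_ i0)[i [_ [s]]]]; apply/negP; rewrite -ltNge.
rewrite (_ : [fset _ in _ | _]%fset = fset0) ?cardfs0 ?mulr_gt0 //.
by apply/fsetP => x; rewrite !inE in_set0 andbF.
Qed.

Lemma positive_densityT : positive_density setT.
Proof.
exists 1 => // i; exists i; split => //; exists None; rewrite mul1r ler_nat.
by apply: fsubset_leq_card; apply/fsubsetP => x; rewrite !inE in_setT andbT.
Qed.

Lemma Dstar_nonempty : Dstar R F !=set0.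
Proof.
(* The filter dual to the ideal of sets without positive density; an ultrafilter extending it
   contains no such set. *)
pose G : set_system S := [set A | ~ positive_density (~` A)].
have GP : ProperFilter G.
  split; last split.
  - by rewrite /G /= setC0; apply; exact: positive_densityT.
  - by rewrite /G /= setCT; exact: not_positive_density0.
  - by move=> A B GA GB; rewrite /G /= setCI => /positive_density_setU[].
  - by move=> A B AB GA; rewrite /G /= => /(positive_densityS (subsetC AB)).
have [p [pU Gp]] := ultraFilterLemma GP.
exists (Beta pU) => A /= pA; apply/upper_density_gt0P.
have [//|nA] := pselect (positive_density A).
have pAC : p (~` A) by apply: Gp; rewrite /G /= setCK.
by have [x []] := filter_ex (filterI pA pAC).
Qed.

Lemma Dstar_mulr b (p q : beta S) : (0 < b)%N ->
  weakly_right_cancellative b S -> Dstar R F p -> Dstar R F (p * q)%g.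
Proof.
move=> b0 hr Dp A /= pqA; apply/upper_density_gt0P.
have /upper_density_gt0P[a a0 Ba] := Dp _ pqA.
have bR : 0 < b%:R :> R by rewrite ltr0n.
exists (a / b%:R); first exact: divr_gt0.
move=> i0; have [i [i0i [s Bs]]] := Ba i0.
exists i; split=> //.
move: Bs; set Y := [fset _ in _ | _]%fset => Bs.
(* Each y in the finite set Y gives a member of q; their intersection is in q, so a single t serves
   all of Y. *)
have [t tP] : exists t, forall y, y \in Y -> A (y * t)%g.
  have qY : q (\bigcap_(y in [set` Y]) [set t | A (y * t)%g]).
    by apply: filter_bigI => y; rewrite !inE => /andP[_ /set_mem].
  have [t tP] := filter_ex qY.
  by exists t => y yY; exact: tP.
(* Y t lies in A and in F_i s t, and has at least |Y|/b elements. *)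
exists (omul s (Some t)); rewrite mulrAC ler_pdivrMr //.
apply: le_trans Bs _; rewrite -natrM ler_nat mulnC.
apply: leq_trans (leq_card_imfset_fibers Y (hr t)) _.
rewrite leq_mul2l; apply/orP; right; apply: fsubset_leq_card.
apply/fsubsetP => _ /imfsetP[y /= yY ->]; rewrite !inE.
rewrite (mem_set (tP _ yY)) andbT.
move: yY; rewrite !inE !rtransE => /andP[/imfsetP[x /= xF ->] _].
by apply/imfsetP; exists x => //=; rewrite oact_omul.
Qed.

Lemma Dstar_mull b (p q : beta S) : (0 < b)%N ->
  weakly_left_cancellative b S -> condition_star R F ->
  Dstar R F p -> Dstar R F (q * p)%g.
Proof.
move=> b0 hl hstar Dp A /= qpA; apply/upper_density_gt0P.
have [t /= pB] := @filter_ex _ q _ _ qpA.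
have /upper_density_gt0P[a a0 Ba] := Dp _ pB.
have bR : 0 < b%:R :> R by rewrite ltr0n.
(* Chosen so that the loss allowed by the star condition, multiplied by b, is half of a|F_i0|. *)
pose e : R := a / (2 * b%:R).
have e0 : 0 < e by rewrite divr_gt0 ?mulr_gt0.
have ab : a = 2 * (b%:R * e) by rewrite /e; field; rewrite gt_eqF.
clearbody e.
have [c [l [c0 starP]]] := hstar e e0 t.
have cR : 0 < c%:R :> R by rewrite ltr0n.
(* Proportion e of F_i0 becomes proportion e/c of F_i, since |F_i| is at most c|F_i0|. *)
exists (e / c%:R); first exact: divr_gt0.
move=> j; have [k [jk lk]] := hI.2 j l.
have [i0 [ki0 [s Bs]]] := Ba k.
have [i [i0i [s' [small le_c]]]] := starP i0 (le_trans lk ki0).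
exists i; split; first by apply: le_trans i0i; apply: le_trans ki0.
exists (omul s' s).
move: Bs; set Y := [fset _ in _ | _]%fset => Bs.
set Z := [fset _ in _ | _]%fset.
set D := (ltrans t (F i0) `\` rtrans (F i) s')%fset in small.
(* An element of t Y is t x s with x in F_i0. If t x lies in F_i s', it is counted in Z; otherwise
   it lies in D s, which has at most |D| elements. *)
have leY : (#|` Y| <= b * (#|` Z| + #|` D|))%N.
  apply: leq_trans (leq_card_imfset_fibers Y (hl t)) _.
  rewrite leq_mul2l; apply/orP; right.
  apply: leq_trans (leq_add (leqnn _) (card_rtrans D s)).
  apply: leq_trans (leq_card_fsetU _ _).1; apply: fsubset_leq_card.
  apply/fsubsetP => _ /imfsetP[y /= yY ->].
  move: yY; rewrite !inE !rtransE => /andP[/imfsetP[x /= xF ->] /set_mem/= Ax].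
  rewrite (mem_set Ax) andbT -oactMl.
  have [txF|txF] := boolP ((t * x)%g \in rtrans (F i) s').
    apply/orP; left; move: txF; rewrite rtransE => /imfsetP[z /= zF ->].
    by apply/imfsetP; exists z => //=; rewrite oact_omul.
  apply/orP; right; apply/imfsetP; exists (t * x)%g => //=.
  by rewrite !inE txF /=; apply/imfsetP; exists x.
rewrite mulrAC ler_pdivrMr //.
move: leY le_c; rewrite -!(ler_nat R) !natrM natrD => leY le_c.
have le_Z : e * #|` F i0|%:R <= #|` Z|%:R.
  rewrite -(ler_pM2l bR).
  have small' := ler_wpM2l (ltW bR) (ltW small).
  rewrite ab in Bs.
  by lra.
rewrite (le_trans (ler_wpM2l (ltW e0) le_c)) // mulrCA [_ * c%:R]mulrC.
by rewrite ler_pM2l.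
Qed.

Lemma Dstar_ideal b : (0 < b)%N -> weakly_left_cancellative b S ->
  weakly_right_cancellative b S -> condition_star R F ->
  two_sided_ideal (Dstar R F).
Proof.
move=> b0 hl hr hstar; split; first exact: Dstar_nonempty.
by move=> q p Dp; split; [exact: (Dstar_mull b0)|exact: (Dstar_mulr b0)].
Qed.

End Dstar_ideal.

Theorem proposition6p2 (R : realType) (b : nat) (hb : (0 < b)%N)
  (S : semigroupType)
  (hS : ([set: S] !=set0)%classic)
  (hl : weakly_left_cancellative b S)
  (hr : weakly_right_cancellative b S)
  (d : Order.disp_t) (I : preorderType d) (hI : directed I)
  (F : I -> {fset S}) (hF : forall i : I, F i != fset0)
  (hstar : condition_star R F)
  (A : set S) (hA : central A) :
  D_set R F A.
Proof.
case: hA => p [pp [Kp pA]]; exists p; split=> //; split=> //.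
(* [smallest] ranges over the ideals that include [set0], whence the trivial second goal. *)
by apply: Kp; split; [exact: (Dstar_ideal hI hF hb)|exact: sub0set].
Qed.
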